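(* Let $R$ be a Prüfer domain with finite character, and suppose that $R$ has the weak factorization property. Then $R$ is $h$-local.
   Context: For an integral domain $R$ with quotient field $K$ and a nonzero fractional ideal $F$ of $R$, put $F^{-1} = (R:F) = \{x \in K \mid xF \subseteq R\}$ and $F^v = (F^{-1})^{-1}$. The domain $R$ has finite character if each nonzero element of $R$ is contained in only finitely many maximal ideals, and $R$ is $h$-local if it has finite character and each nonzero prime ideal of $R$ is contained in a unique maximal ideal of $R$. A Prüfer domain $R$ has the weak factorization property if each nonzero ideal $I$ of $R$ can be written as $I = I^v\Pi$, where $\Pi$ is a finite product of (not necessarily distinct) maximal ideals of $R$ (the empty product being $R$). *)

(* Defs.v *)
From HB Require Import structures.
From mathcomp Require Import all_boot all_order all_algebra.
From mathcomp Require Import all_classical.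

Set Implicit Arguments.
Unset Strict Implicit.
Unset Printing Implicit Defensive.

Import GRing.Theory.

Local Open Scope ring_scope.
Local Open Scope classical_set_scope.

(* ring_quotient.v has boolean, necessarily proper ideals; here ideals are
   arbitrary subsets, and R itself is an ideal. *)
Section Ideals.
Variable R : idomainType.
Implicit Types (I J M P : set R).

Definition is_ideal I :=
  I 0 /\ forall a x y, I x -> I y -> I (a * x + y).

Definition prime_ideal P :=
  [/\ is_ideal P, P <> setT & forall x y, P (x * y) -> P x \/ P y].

Definition maximal_ideal M :=
  [/\ is_ideal M, M <> setT &
      forall J, is_ideal J -> M `<=` J -> J <> setT -> J = M].

Definition finitely_generated I :=
  exists (n : nat) (a : 'I_n -> R),
    I = [set \sum_(i < n) c i * a i | c in [set: 'I_n -> R]].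

Definition finite_character :=
  forall x : R, x != 0 -> finite_set [set M | maximal_ideal M /\ M x].

Definition h_local :=
  finite_character /\
  forall P, prime_ideal P -> P <> [set 0] ->
    exists! M, maximal_ideal M /\ P `<=` M.

Lemma prime_idealE P :
  prime_ideal P <-> idealr_closed [in P] /\ prime_idealr_closed [in P].
Proof.
split=> [[[P0 PD] PT PM]|[[]]].
  split; last by move=> u v /set_mem/PM[]/mem_set ->; rewrite ?orbT.
  split; [exact/mem_set| |by move=> a u v /set_mem ? /set_mem ?; apply/mem_set/PD].
  apply/negP => /set_mem P1; apply: PT; apply/seteqP; split=> // x _.
  by rewrite -[x]mulr1 -[x * 1]addr0; exact: PD.
move=> /set_mem P0 /negP P1 PD PM; split.
- by split=> // a x y Px Py; apply/set_mem/PD; exact/mem_set.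
- by move=> PT; apply: P1; apply/mem_set; rewrite PT.
- by move=> x y /mem_set/PM/orP[]/set_mem ?; [left|right].
Qed.

End Ideals.

Section FractionalIdeals.
Variable R : idomainType.
Local Notation K := {fraction R}.
Implicit Types (A B F : set K) (I : set R).

(* The copy in K of a subset of R. *)
Definition in_frac I : set K := (@tofrac R) @` I.

(* The R-submodule generated by the products x * y: finite sums of products. *)
Definition module_mul A B : set K :=
  [set z | exists (n : nat) (x y : 'I_n -> K),
     [/\ forall i, A (x i), forall i, B (y i) & z = \sum_(i < n) x i * y i]].

(* F^-1 = (R : F); below it is only applied to nonzero fractional ideals. *)
Definition frac_inv F : set K :=
  [set x | forall y, F y -> in_frac setT (x * y)].

Definition frac_v F : set K := frac_inv (frac_inv F).

Definition invertible F := module_mul F (frac_inv F) = in_frac setT.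

End FractionalIdeals.

Definition prufer_domain (R : idomainType) :=
  forall I : set R, is_ideal I -> I <> [set 0] -> finitely_generated I ->
    invertible (in_frac I).

(* The equation I = I^v * M_1 * ... * M_n is read in K; repetitions among the
   M_i are allowed and n = 0 gives the empty product R. *)
Definition weak_factorization (R : idomainType) :=
  forall I : set R, is_ideal I -> I <> [set 0] ->
    exists (n : nat) (M : 'I_n -> set R),
      (forall i, maximal_ideal (M i)) /\
      in_frac I = module_mul (frac_v (in_frac I))
        (\big[@module_mul R/in_frac setT]_(i < n) in_frac (M i)).

(* Main.v *)
Require Import Defs.
From mathcomp Require Import all_boot all_order all_algebra.
From mathcomp Require Import all_classical.
From mathcomp Require Import ring.

(** Let [M] and [N] be distinct maximal ideals containing a common nonzero
    prime [P], and let [Q] be the largest prime ideal inside both of them, so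
    that [R_Q = R_M R_N].  For a nonzero [x] in [P], the ideal
    [I = x R_M ∩ R] is locally [x R_M] at [M], but its divisorial closure
    cannot tell [R_M] from [R_Q]: it contains [x R_Q ∩ R]
    (lemma [inverse_absorbs]).  Indeed, if [z] is in [I^-1], then at [N] the
    module [z x R_Q] lies in [R_N], which forces [z x] into [Q]
    (lemma [inverse_times_generator]); and elements of [Q] stay integral at
    every maximal ideal containing [Q] when divided by elements outside [Q].
    At a maximal ideal [L] not containing [Q], the ideals [I] and
    [x R_Q ∩ R] already agree.

    A product [Π] of maximal ideals cannot repair this.  No maximal ideal lies
    in [Q], so [Π] has an element outside [Q], that is, [Π R_Q = R_Q], and
    [I = I^v Π] would give [x R_Q ⊆ x R_M], hence [R_Q = R_M], although [Q] is
    strictly smaller than [M].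

    Invertibility of two-generated ideals is what makes divisibility at a
    maximal ideal total (lemma [divides_at_total]); localizations are handled
    only through the relation [divides_at]. *)

Set Implicit Arguments.
Unset Strict Implicit.
Unset Printing Implicit Defensive.

Import GRing.Theory.
Local Open Scope ring_scope.
Local Open Scope classical_set_scope.

(** * Maximal ideals *)

Section MaximalIdeals.
Variable R : idomainType.
Implicit Types (I J L M N : set R).

Lemma ideal_mull I a x : is_ideal I -> I x -> I (a * x).
Proof. by move=> [I0 ID] Ix; rewrite -[_ * _]addr0; exact: ID. Qed.

Lemma ideal_mulr I a x : is_ideal I -> I x -> I (x * a).
Proof. by rewrite mulrC; exact: ideal_mull. Qed.

Lemma ideal_add I x y : is_ideal I -> I x -> I y -> I (x + y).
Proof. by move=> [_ ID] Ix Iy; rewrite -[x]mul1r; exact: ID. Qed.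

Lemma ideal_setT I : is_ideal I -> I 1 -> I = setT.
Proof.
move=> idI I1; apply/seteqP; split=> // x _.
by rewrite -[x]mulr1; exact: ideal_mull.
Qed.

Lemma maximal_not1 M : maximal_ideal M -> ~ M 1.
Proof. by move=> [idM MT _] /(ideal_setT idM). Qed.

Lemma maximal_prime M : maximal_ideal M -> prime_ideal M.
Proof.
move=> [idM MT Mmax]; split=> // a b Mab.
have [Ma|Ma] := pselect (M a); first by left.
right.
pose J := [set y | exists m c, M m /\ y = m + c * a].
have idJ : is_ideal J.
  split; first by exists 0, 0; split; [case: idM | ring].
  move=> e y y' [m [c [Mm ->]]] [m' [c' [Mm' ->]]].
  exists (e * m + m'), (e * c + c'); split; last by ring.
  by case: idM => _; apply.
have sMJ : M `<=` J by move=> m Mm; exists m, 0; split=> //; ring.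
have JT : J = setT.
  apply: contrapT => JT; apply: Ma; rewrite -(Mmax J idJ sMJ JT).
  by exists 0, 1; split; [case: idM | ring].
have [m [c [Mm e1]]] : J 1 by rewrite JT.
have -> : b = b * m + c * (a * b).
  by transitivity (b * (m + c * a)); [rewrite -e1 mulr1 | ring].
by apply: (ideal_add idM); apply: ideal_mull.
Qed.

Lemma maximal_compl_mul M a b :
  maximal_ideal M -> ~ M a -> ~ M b -> ~ M (a * b).
Proof. by move=> /maximal_prime[_ _ Mp] Ma Mb /Mp[]. Qed.

Lemma maximal_sub_eq M N :
  maximal_ideal M -> maximal_ideal N -> M `<=` N -> M = N.
Proof. by move=> [_ _ Mmax] [idN NT _] sMN; rewrite (Mmax N). Qed.

Lemma maximal_not_sub M N :
  maximal_ideal M -> maximal_ideal N -> M <> N -> exists2 a, M a & ~ N a.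
Proof.
move=> mM mN MN; apply: contrapT => nex; apply: MN; apply: maximal_sub_eq => //.
by move=> a Ma; apply: contrapT => Na; apply: nex; exists a.
Qed.

Lemma exists_maximal J :
  is_ideal J -> J <> setT -> exists2 M, maximal_ideal M & J `<=` M.
Proof.
move=> idJ JT.
(* Adjoining [J] makes the empty chain have the proper ideal [J] as union. *)
pose proper (A : set R) := is_ideal (A `|` J) /\ ~ (A `|` J) 1.
have [F sF tot|A [[idA A1] Amax]] := @Zorn_bigcup R proper.
  split; last first.
    move=> [[A FA A1]|J1]; first by have [_] := sF A FA; apply; left.
    by apply: JT; exact: ideal_setT.
  split; first by right; case: idJ.
  have inA A : F A -> forall a x y, (A `|` J) x -> (A `|` J) y ->
      (\bigcup_(X in F) X `|` J) (a * x + y).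
    move=> FA a x y Ax Ay; have [[_ AD] _] := sF A FA.
    by have [AA|] := AD a x y Ax Ay; [left; exists A | right].
  move=> a x y [[A FA Ax]|Jx] [[B FB By]|Jy].
  - have [sAB|sBA] := tot A B FA FB.
      by apply: (inA B) => //; left=> //; exact: sAB.
    by apply: (inA A) => //; left=> //; exact: sBA.
  - by apply: (inA A) => //; [left | right].
  - by apply: (inA B) => //; [right | left].
  - by right; case: idJ => _; apply.
exists (A `|` J); last by move=> x; right.
split=> //; first by move=> AT; apply: A1; rewrite AT.
move=> B idB sAB BT; apply/seteqP; split=> // x Bx; left.
apply: contrapT => Ax; apply: (Amax B).
  split; first by move=> y Ay; apply: sAB; left.
  by move=> sBA; apply: Ax; exact: sBA.
rewrite /proper; have -> : B `|` J = B.
  by apply/seteqP; split=> y; [move=> [//|Jy]; apply: sAB; right | left].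
by split=> // B1; apply: BT; exact: ideal_setT.
Qed.

End MaximalIdeals.

(** * Divisibility at a maximal ideal *)

Section Divisibility.
Variable R : idomainType.
Implicit Types (L M N : set R).
Local Notation K := {fraction R}.
Local Notation "x %:F" := (@tofrac R x).

Lemma in_fracE (I : set R) (a : R) : in_frac I (a%:F) -> I a.
Proof. by move=> [b Ib /eqP]; rewrite tofrac_eq => /eqP <-. Qed.

(** The membership [a \in b R_M]. *)
Definition divides_at M (b a : R) := exists t c, ~ M t /\ t * a = b * c.

(** If [y, y'] lie in [(a, b)^-1] and [a y + b y' = 1], then one of the two
    summands is outside [M]; it serves as the denominator. *)
Lemma divides_at_total M (a b : R) : prufer_domain R -> maximal_ideal M ->
  divides_at M a b \/ divides_at M b a.
Proof.
move=> prufer mM; have M1 := maximal_not1 mM; have [idM _ _] := mM.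
have [->|a0] := eqVneq a 0; first by right; exists 1, 0; split=> //; ring.
pose g (i : 'I_2) : R := if i == 0 then a else b.
pose I := [set \sum_(i < 2) c i * g i | c in [set: 'I_2 -> R]].
have gI c d : I (c * a + d * b).
  exists (fun i : 'I_2 => if i == 0 then c else d) => //.
  by rewrite !big_ord_recl big_ord0 /g /= addr0.
have idI : is_ideal I.
  split; first by have := gI 0 0; rewrite !mul0r addr0.
  move=> e x y [c _ <-] [d _ <-]; exists (fun i => e * c i + d i) => //.
  rewrite big_distrr -big_split /=; apply: eq_bigr => i _; ring.
have aI : I a by have := gI 1 0; rewrite mul1r mul0r addr0.
have bI : I b by have := gI 0 1; rewrite mul1r mul0r add0r.
have I0 : I <> [set 0] by move=> e; move: aI; rewrite e => /eqP; exact/negP.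
have Ifg : finitely_generated I by exists 2, g.
have : in_frac setT (1%:F : K) by exists 1.
rewrite -(prufer I idI I0 Ifg) => -[n [x [y [xI yI e1]]]].
have inv2 i : exists p : (R * R) * (R * R),
   [/\ (y i * a%:F = p.1.1%:F), (y i * b%:F = p.1.2%:F) &
       x i = p.2.1%:F * a%:F + p.2.2%:F * b%:F].
  have [u _ eu] : in_frac setT (y i * a%:F) by apply: yI; exists a.
  have [v _ ev] : in_frac setT (y i * b%:F) by apply: yI; exists b.
  have [w [c _ <-] ew] := xI i.
  exists ((u, v), (c 0, c (lift 0 0))); split=> //=.
  by rewrite -ew !big_ord_recl big_ord0 /g /= addr0 tofracD !tofracM.
have [p pE] := choice inv2.
pose ay := \sum_i (p i).2.1 * (p i).1.1.
pose by_ := \sum_i (p i).2.1 * (p i).1.2.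
pose ay' := \sum_i (p i).2.2 * (p i).1.1.
pose by' := \sum_i (p i).2.2 * (p i).1.2.
have sum1 : 1 = ay + by'.
  apply/eqP; rewrite -tofrac_eq e1 -big_split /= rmorph_sum /=; apply/eqP.
  apply: eq_bigr => i _; have [eu ev ->] := pE i.
  by rewrite tofracD !tofracM -eu -ev; ring.
have cross i : a * (p i).1.2 = b * (p i).1.1.
  apply/eqP; rewrite -tofrac_eq !tofracM; have [<- <- _] := pE i.
  by apply/eqP; ring.
have [May|May] := pselect (M ay); [right|left].
  exists by', ay'; split.
    by move=> Mby; apply: M1; rewrite sum1; exact: ideal_add.
  rewrite mulr_suml mulr_sumr; apply: eq_bigr => i _.
  by transitivity ((p i).2.2 * (a * (p i).1.2)); [ring | rewrite cross; ring].
exists ay, by_; split=> //.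
rewrite mulr_suml mulr_sumr; apply: eq_bigr => i _.
by transitivity ((p i).2.1 * (b * (p i).1.1)); [ring | rewrite -cross; ring].
Qed.

(** The denominators of [z] form an ideal, contained in no maximal ideal. *)
Lemma integral_locally (z : K) :
  (forall L, maximal_ideal L -> exists2 s, ~ L s & in_frac setT (s%:F * z)) ->
  in_frac setT z.
Proof.
move=> loc; pose D := [set s : R | in_frac setT (s%:F * z)].
have idD : is_ideal D.
  split; first by exists 0 => //; rewrite tofrac0 mul0r.
  move=> a s s' [u _ eu] [v _ ev]; exists (a * u + v) => //.
  by rewrite !tofracD !tofracM eu ev; ring.
have [DT|DT] := pselect (D = setT).
  by have : D 1 by [rewrite DT]; rewrite /D /= tofrac1 mul1r.
have [L mL sDL] := exists_maximal idD DT.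
by have [s Ls /sDL] := loc L mL.
Qed.

(** The ideal [x R_M ∩ R]. *)
Definition local_contraction M (x : R) : set R := [set a | divides_at M x a].

Lemma local_contraction_ideal M x :
  maximal_ideal M -> is_ideal (local_contraction M x).
Proof.
move=> mM; split.
  by exists 1, 0; split; [exact: maximal_not1 | ring].
move=> e a b [s [c [Ms ea]]] [t [d [Mt eb]]].
exists (s * t), (e * t * c + s * d); split; first exact: maximal_compl_mul.
transitivity (e * t * (s * a) + s * (t * b)); first by ring.
by rewrite ea eb; ring.
Qed.

Lemma local_contraction_self M x : maximal_ideal M -> local_contraction M x x.
Proof. by move=> mM; exists 1, 1; split; [exact: maximal_not1 | ring]. Qed.

End Divisibility.

(** * The largest prime ideal inside two maximal ideals *)

Section CommonPrime.
Variable R : idomainType.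
Hypothesis prufer : prufer_domain R.
Variables M N : set R.
Hypotheses (mM : maximal_ideal M) (mN : maximal_ideal N) (MN : M <> N).
Local Notation K := {fraction R}.
Local Notation "x %:F" := (@tofrac R x).

(** The elements that remain nonunits in [R_M R_N]. *)
Definition common_prime : set R :=
  [set a | forall s u d, ~ N s -> ~ M u -> a * d <> s * u].
Local Notation Q := common_prime.

Lemma common_primePn a :
  ~ Q a -> exists s u d, [/\ ~ N s, ~ M u & a * d = s * u].
Proof.
move=> Qa; apply: contrapT => nex; apply: Qa => s u d Ns Mu e; apply: nex.
by exists s, u, d.
Qed.

Lemma common_prime_mul a b : Q a -> Q (b * a).
Proof.
move=> Qa s u d Ns Mu e; apply: (Qa s u (b * d) Ns Mu).
by rewrite -e; ring.
Qed.

Lemma common_prime_compl_mul a b : ~ Q a -> ~ Q b -> ~ Q (a * b).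
Proof.
move=> /common_primePn[s [u [d [Ns Mu e]]]].
move=> /common_primePn[s' [u' [d' [Ns' Mu' e']]]] Qab.
apply: (Qab (s * s') (u * u') (d * d')); try exact: maximal_compl_mul.
by transitivity ((a * d) * (b * d')); [ring | rewrite e e'; ring].
Qed.

Lemma common_prime_subl : Q `<=` M.
Proof.
move=> a Qa; apply: contrapT => Ma.
by apply: (Qa 1 a 1) => //; [exact: maximal_not1 | ring].
Qed.

Lemma common_prime_subr : Q `<=` N.
Proof.
move=> a Qa; apply: contrapT => Na.
by apply: (Qa a 1 1) => //; exact: maximal_not1.
Qed.

Lemma prime_sub_common P :
  prime_ideal P -> P `<=` M -> P `<=` N -> P `<=` Q.
Proof.
move=> [idP _ Pp] sPM sPN a Pa s u d Ns Mu e.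
have : P (s * u) by rewrite -e; exact: ideal_mulr.
by move=> /Pp[/sPN|/sPM].
Qed.

Lemma maximal_not_sub_common L : maximal_ideal L -> exists2 a, L a & ~ Q a.
Proof.
move=> mL; apply: contrapT => nex.
have sLQ : L `<=` Q.
  by move=> a La; apply: contrapT => Qa; apply: nex; exists a.
apply: MN; rewrite -(maximal_sub_eq mL mM); last first.
  exact: subset_trans common_prime_subl.
by apply: maximal_sub_eq mL mN _; exact: subset_trans common_prime_subr.
Qed.

(** In a valuation ring, a prime ideal lies below every element outside it. *)
Lemma common_prime_divides L a b :
  maximal_ideal L -> Q `<=` L -> Q a -> ~ Q b -> divides_at L b a.
Proof.
move=> mL sQL Qa Qb; have [[t [c [Lt e]]]|//] := divides_at_total a b prufer mL.
have Qt : ~ Q t by move=> /sQL.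
case: (common_prime_compl_mul Qt Qb).
by rewrite e mulrC; exact: common_prime_mul.
Qed.

Variable x : R.
Hypothesis Qx : Q x.
Local Notation I := (local_contraction M x).

(** At [N], every [x / u] with [u] outside [M] lies in [I R_N], so [y = z x] is
    divisible in [R_N] by every such [u].  Were [y] outside [Q], it would divide some
    [s u] with [s] outside [N]; dividing [y] by [u u'] with [u'] in [N] but not
    in [M] then puts [s] in [N]. *)
Lemma inverse_times_generator (z : K) (y : R) :
  frac_inv (in_frac I) z -> y%:F = z * x%:F -> Q y.
Proof.
move=> zI ey; apply: contrapT => /common_primePn[s [u [d [Ns Mu e]]]].
have [u' Nu' Mu'] := maximal_not_sub mN mM (nesym MN).
have Muu' : ~ M (u * u') by exact: maximal_compl_mul.
have Quu' : ~ Q (u * u') by move=> /common_prime_subl.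
have [s' [i [Ns' ei]]] := common_prime_divides mN common_prime_subr Qx Quu'.
have Ii : I i by exists (u * u'), s'; split=> //; rewrite -ei mulrC.
have [j _ ej] : in_frac setT (z * i%:F) by apply: zI; exists i.
have e' : s' * y = u * u' * j.
  apply/eqP; rewrite -tofrac_eq [(s' * y)%:F]tofracM ey.
  rewrite [(_ * j)%:F]tofracM ej mulrCA -tofracM ei tofracM.
  by apply/eqP; ring.
have u0 : u != 0.
  by apply/eqP => u0; apply: Mu; rewrite u0; case: mM => -[].
have ess : s' * s = u' * (j * d).
  apply: (mulfI u0); transitivity (s' * (s * u)); first by ring.
  by rewrite -e; transitivity (s' * y * d); [ring | rewrite e'; ring].
apply: (maximal_compl_mul mN Ns' Ns); rewrite ess.
by apply: ideal_mulr => //; case: mN.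
Qed.

(** [r = t x / q] is a typical element of [x R_Q ∩ R]. *)
Lemma inverse_absorbs (q r t : R) :
  ~ Q q -> r * q = t * x -> frac_v (in_frac I) (r%:F).
Proof.
move=> Qq er z zI.
have [y _ ey] : in_frac setT (z * x%:F).
  by apply: zI; exists x => //; exact: local_contraction_self.
have Qy := inverse_times_generator zI ey.
have q0 : q%:F != 0 :> K.
  rewrite tofrac_eq0; apply/eqP => q0; apply: Qq.
  by rewrite q0 -(mul0r x); exact: common_prime_mul.
apply: integral_locally => L mL.
have [sQL|nQL] := pselect (Q `<=` L).
  have [s [c [Ls e]]] := common_prime_divides mL sQL Qy Qq.
  exists s => //; exists (t * c) => //.
  apply: (mulfI q0).
  transitivity (t%:F * (s * y)%:F); first by rewrite e !tofracM; ring.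
  transitivity (s%:F * (r * q)%:F * z); last by rewrite tofracM; ring.
  by rewrite er !tofracM ey; ring.
have [a Qa La] : exists2 a, Q a & ~ L a.
  apply: contrapT => nex; apply: nQL => a Qa.
  by apply: contrapT => La; apply: nex; exists a.
(* Here [q] divides [a] in [R_M], so [a r] is already in [I]. *)
have [v [c [Mv e]]] := common_prime_divides mM common_prime_subl Qa Qq.
exists a => //.
have -> : a%:F * (r%:F * z) = z * (a * r)%:F by rewrite tofracM; ring.
apply: zI; exists (a * r) => //; exists v, (c * t); split=> //.
transitivity (v * a * r); first by ring.
by rewrite e; transitivity (c * (r * q)); [ring | rewrite er; ring].
Qed.

End CommonPrime.

(** * Products of maximal ideals *)

Section Products.
Variable R : idomainType.
Local Notation "x %:F" := (@tofrac R x).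

Lemma module_mul_mem (A B : set {fraction R}) a b :
  A a -> B b -> module_mul A B (a * b).
Proof.
move=> Aa Bb; exists 1, (fun=> a), (fun=> b); split=> //.
by rewrite big_ord_recl big_ord0 addr0.
Qed.

(** The complement of [Q] is multiplicative and meets every maximal ideal, so
    it also meets their products. *)
Lemma prod_maximal_not_sub_common (M N : set R) n (L : 'I_n -> set R) :
  maximal_ideal M -> maximal_ideal N -> M <> N ->
  (forall i, maximal_ideal (L i)) ->
  exists2 a, ~ common_prime M N a &
    (\big[@module_mul R/in_frac setT]_(i < n) in_frac (L i)) a%:F.
Proof.
move=> mM mN MN mL.
apply: (big_ind (fun A : set {fraction R} =>
  exists2 a, ~ common_prime M N a & A a%:F)).
- exists 1; last by exists 1.
  by move=> /(common_prime_subl mN); exact: maximal_not1.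
- move=> A B [a Qa Aa] [b Qb Bb]; exists (a * b).
    exact: common_prime_compl_mul.
  by rewrite tofracM; exact: module_mul_mem.
- move=> i _; have [a La Qa] := maximal_not_sub_common mM mN MN (mL i).
  by exists a => //; exists a.
Qed.

End Products.

(** * Uniqueness of the maximal ideal above a nonzero prime *)

Lemma prime_in_unique_maximal (R : idomainType) (P M N : set R) :
  prufer_domain R -> weak_factorization R ->
  prime_ideal P -> P <> [set 0] ->
  maximal_ideal M -> maximal_ideal N -> P `<=` M -> P `<=` N -> M = N.
Proof.
move=> prufer weak pP P0 mM mN sPM sPN; apply: contrapT => MN.
have [x Px x0] : exists2 x, P x & x != 0.
  apply: contrapT => nex; apply: P0; apply/seteqP; split=> [a Pa|_ ->].
    by apply: contrapT => /eqP a0; apply: nex; exists a.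
  by case: pP => -[].
have Qx : common_prime M N x by exact: (prime_sub_common pP sPM sPN).
pose I := local_contraction M x.
have I0 : I <> [set 0].
  move=> e; have : I x by exact: local_contraction_self.
  by rewrite e => /eqP; exact/negP.
have [n [L [mL fact]]] := weak I (local_contraction_ideal x mM) I0.
have [p Qp Lp] := prod_maximal_not_sub_common mM mN MN mL.
have [m Mm Qm] := maximal_not_sub_common mM mN MN mM.
(* The element [r = t x / (m p)] of [x R_Q ∩ R] has [r p = t x / m], which is
   not in [x R_M] because [t] is outside [M] and [m] is in [M]. *)
have Qmp : ~ common_prime M N (m * p) by exact: common_prime_compl_mul.
have [t [r [Mt e]]] :=
  common_prime_divides prufer mM mN mM (common_prime_subl mN) Qx Qmp.
have rv : frac_v (in_frac I) (tofrac r).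
  by apply: (inverse_absorbs prufer mM mN MN Qx Qmp (t := t)); rewrite e mulrC.
have : in_frac I (tofrac (r * p)).
  by rewrite fact tofracM; exact: module_mul_mem.
move=> /in_fracE[v [c [Mv ev]]].
apply: (maximal_compl_mul mM Mv Mt).
have -> : v * t = c * m.
  apply: (mulIf x0); transitivity (v * (t * x)); first by ring.
  by rewrite e; transitivity (v * (r * p) * m); [ring | rewrite ev; ring].
by apply: ideal_mull => //; case: mM.
Qed.

Theorem theorem1p13 (R : idomainType)
    (hprufer : prufer_domain R)
    (hfin : finite_character R)
    (hweak : weak_factorization R) :
  h_local R.
Proof.
split=> // P pP P0; have [idP PT _] := pP.
have [M mM sPM] := exists_maximal idP PT.
exists M; split=> // N [mN sPN].
exact: (prime_in_unique_maximal hprufer hweak pP P0).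
Qed.
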